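(* If $G$ is a perfect group, then the natural homomorphism $\pi\colon\mathrm{Pol}_2(G)\to G$ is an isomorphism. Consequently, every unital polynomial map (of any degree, with values in any group) defined on a perfect group is a group homomorphism.
   Context: For groups $G,H$ and $\varphi\colon G\to H$, put $(\Delta_k\varphi)(g):=\varphi(kg)\varphi(g)^{-1}$. A map is polynomial of degree $-1$ if it is constantly $1$, and polynomial of degree $d+1$ ($d\ge-1$) if $\Delta_k\varphi$ is polynomial of degree $d$ for all $k\in G$; quadratic means polynomial of degree $2$; unital means $\varphi(1)=1$. $\mathrm{Pol}_2(G)$ is the group with a universal unital quadratic map $\varphi\colon G\to\mathrm{Pol}_2(G)$: every unital quadratic map $\varphi'\colon G\to H$ to a group $H$ equals $\theta\circ\varphi$ for a unique homomorphism $\theta\colon\mathrm{Pol}_2(G)\to H$. The natural homomorphism $\pi\colon\mathrm{Pol}_2(G)\to G$ is the one corresponding to the unital quadratic map $\mathrm{id}\colon G\to G$, i.e. $\pi(\varphi(g))=g$. A group is perfect if $G=[G,G]$. *)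

(* Defs.v *)
From HB Require Import structures.
From mathcomp Require Import all_boot.
From mathcomp Require Import boolp classical_sets.

Set Implicit Arguments.
Unset Strict Implicit.
Unset Printing Implicit Defensive.

Local Open Scope classical_set_scope.
Local Open Scope group_scope.

Definition commutators (G : groupType) : set G :=
  [set c | exists x y : G, c = [~ x, y]].

Definition derived_subgroup (G : groupType) : set G :=
  smallest (fun S : set G => group_closed [in S]) (@commutators G).

Arguments derived_subgroup G : clear implicits.

Definition perfect (G : groupType) : Prop := derived_subgroup G = [set: G].

Definition gdiff (G H : groupType) (k : G) (f : G -> H) : G -> H :=
  fun g => f (k * g) * (f g)^-1.

(* The index is shifted by one, so that degree -1 is available:
   [polynomial_lt n f] says that [f] is polynomial of degree [n - 1]. *)
Fixpoint polynomial_lt (G H : groupType) (n : nat) (f : G -> H) : Prop :=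
  match n with
  | 0 => forall g, f g = 1
  | n'.+1 => forall k, polynomial_lt n' (gdiff k f)
  end.

Definition quadratic (G H : groupType) (f : G -> H) : Prop :=
  polynomial_lt 3 f.

Definition unital (G H : groupType) (f : G -> H) : Prop := f 1 = 1.

(* Pol_2(G) is only determined up to unique isomorphism: an element of [pol2 G]
   is a group together with a universal unital quadratic map from G. *)
Record pol2 (G : groupType) := Pol2 {
  pol2_group :> groupType;
  pol2_map : G -> pol2_group;
  pol2_map_unital : unital pol2_map;
  pol2_map_quadratic : quadratic pol2_map;
  pol2_universal : forall (H : groupType) (f : G -> H),
    unital f -> quadratic f ->
    exists theta : {multiplicative pol2_group -> H},
      (forall g, theta (pol2_map g) = f g) /\
      (forall theta' : {multiplicative pol2_group -> H},
         (forall g, theta' (pol2_map g) = f g) -> theta' =1 theta)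
}.

Lemma unital_id (G : groupType) : unital (@id G).
Proof. by []. Qed.

Lemma quadratic_id (G : groupType) : quadratic (@id G).
Proof. by move=> k l m g; rewrite /gdiff /= !mulgK !mulgV. Qed.

Definition pol2_proj (G : groupType) (P : pol2 G) : {multiplicative P -> G} :=
  projT1 (cid (pol2_universal P (@unital_id G) (@quadratic_id G))).

Lemma pol2_projE (G : groupType) (P : pol2 G) (g : G) :
  pol2_proj P (pol2_map P g) = g.
Proof. by rewrite /pol2_proj; case: cid => theta []. Qed.

(* Existence of Pol_2(G), for every group G: words in the letters g and g^-1
   for g in G, modulo equality under all unital quadratic maps. *)
Section Existence.
Variable G : groupType.

Definition letter (H : groupType) (f : G -> H) (p : G * bool) : H :=
  if p.2 then (f p.1)^-1 else f p.1.

Definition word_eval (H : groupType) (f : G -> H) (w : seq (G * bool)) : H :=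
  \prod_(p <- w) letter f p.

Lemma word_eval_cat (H : groupType) (f : G -> H) v w :
  word_eval f (v ++ w) = word_eval f v * word_eval f w.
Proof. by rewrite /word_eval big_cat. Qed.

Definition word_inv (w : seq (G * bool)) : seq (G * bool) :=
  rev [seq (p.1, ~~ p.2) | p <- w].

Lemma word_eval_inv (H : groupType) (f : G -> H) w :
  word_eval f (word_inv w) = (word_eval f w)^-1.
Proof.
elim: w => [|p w IH]; first by rewrite /word_eval !big_nil invg1.
rewrite /word_inv /= rev_cons -cats1 word_eval_cat IH /word_eval.
by rewrite big_seq1 big_cons invgM /letter /=; case: p.2; rewrite ?invgK.
Qed.

Definition word_eqP (v w : seq (G * bool)) : Prop :=
  forall (H : groupType) (f : G -> H), unital f -> quadratic f ->
    word_eval f v = word_eval f w.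

Definition word_eq (v w : seq (G * bool)) : bool := `[< word_eqP v w >].

Lemma word_eq_refl : reflexive word_eq.
Proof. by move=> w; apply/asboolP. Qed.

Lemma word_eq_sym : symmetric word_eq.
Proof.
by move=> v w; apply/asboolP/asboolP => E H f uf qf; rewrite (E H f uf qf).
Qed.

Lemma word_eq_trans : transitive word_eq.
Proof.
move=> v u w /asboolP E1 /asboolP E2; apply/asboolP => H f uf qf.
by rewrite (E1 H f uf qf) (E2 H f uf qf).
Qed.

Canonical word_equiv := EquivRel word_eq word_eq_refl word_eq_sym word_eq_trans.

Local Open Scope quotient_scope.

Definition words := {eq_quot word_equiv}.
HB.instance Definition _ := Choice.on words.

Definition qeval (H : groupType) (f : G -> H) (x : words) : H :=
  word_eval f (repr x).

Lemma qeval_pi (H : groupType) (f : G -> H) w : unital f -> quadratic f ->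
  qeval f (\pi_words w) = word_eval f w.
Proof.
move=> uf qf; rewrite /qeval; case: piP => v /eqmodP /asboolP E.
by rewrite (E H f uf qf).
Qed.

Lemma words_ext (x y : words) :
  (forall (H : groupType) (f : G -> H), unital f -> quadratic f ->
     qeval f x = qeval f y) -> x = y.
Proof.
by move=> E; rewrite -[x]reprK -[y]reprK; apply/eqmodP/asboolP.
Qed.

Definition qmul (x y : words) : words := \pi_words (repr x ++ repr y).
Definition qone : words := \pi_words [::].
Definition qinv (x : words) : words := \pi_words (word_inv (repr x)).

Lemma qevalM (H : groupType) (f : G -> H) x y : unital f -> quadratic f ->
  qeval f (qmul x y) = qeval f x * qeval f y.
Proof. by move=> uf qf; rewrite qeval_pi // word_eval_cat. Qed.

Lemma qeval1 (H : groupType) (f : G -> H) : unital f -> quadratic f ->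
  qeval f qone = 1.
Proof. by move=> uf qf; rewrite qeval_pi // /word_eval big_nil. Qed.

Lemma qevalV (H : groupType) (f : G -> H) x : unital f -> quadratic f ->
  qeval f (qinv x) = (qeval f x)^-1.
Proof. by move=> uf qf; rewrite qeval_pi // word_eval_inv. Qed.

Lemma qmulA : associative qmul.
Proof. by move=> x y z; apply: words_ext => H f uf qf; rewrite !qevalM // mulgA. Qed.

Lemma qmul1 : left_id qone qmul.
Proof. by move=> x; apply: words_ext => H f uf qf; rewrite qevalM // qeval1 // mul1g. Qed.

Lemma q1mul : right_id qone qmul.
Proof. by move=> x; apply: words_ext => H f uf qf; rewrite qevalM // qeval1 // mulg1. Qed.

Lemma qmulV : left_inverse qone qinv qmul.
Proof.
by move=> x; apply: words_ext => H f uf qf; rewrite qevalM // qevalV // qeval1 // mulVg.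
Qed.

Lemma qVmul : right_inverse qone qinv qmul.
Proof.
by move=> x; apply: words_ext => H f uf qf; rewrite qevalM // qevalV // qeval1 // mulgV.
Qed.

HB.instance Definition _ := isGroup.Build words qmulA qmul1 q1mul qmulV qVmul.

Definition wgen (g : G) : words := \pi_words [:: (g, false)].

Lemma qeval_wgen (H : groupType) (f : G -> H) g : unital f -> quadratic f ->
  qeval f (wgen g) = f g.
Proof. by move=> uf qf; rewrite qeval_pi // /word_eval big_seq1. Qed.

Lemma wgen_unital : unital wgen.
Proof.
by apply: words_ext => H f uf qf; rewrite qeval_wgen // uf [RHS]qeval1.
Qed.

Lemma wgen_quadratic : quadratic wgen.
Proof.
move=> k l m g; apply: words_ext => H f uf qf.
have eM (x y : words) : qeval f (x * y) = qeval f x * qeval f y by exact: qevalM.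
have eV (x : words) : qeval f x^-1 = (qeval f x)^-1 by exact: qevalV.
have eP : forall x, qeval f (wgen x) = f x by move=> x; apply: qeval_wgen.
by rewrite [RHS]qeval1 // -(qf k l m g) /gdiff !(eM, eV) !eP.
Qed.

Lemma words_universal (H : groupType) (f : G -> H) :
  unital f -> quadratic f ->
  exists theta : {multiplicative words -> H},
    (forall g, theta (wgen g) = f g) /\
    (forall theta' : {multiplicative words -> H},
       (forall g, theta' (wgen g) = f g) -> theta' =1 theta).
Proof.
move=> uf qf.
have qM : {morph qeval f : x y / x * y} by move=> x y; exact: qevalM.
pose theta : {multiplicative words -> H} :=
  HB.pack (qeval f) (isMultiplicative.Build words H (qeval f) qM).
exists theta; split=> [g|theta' E x]; first exact: qeval_wgen.
have T1 : theta' 1 = 1.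
  by apply: (mulgI (theta' 1)); rewrite mulg1 -gmulfM mulg1.
have TV y : theta' y^-1 = (theta' y)^-1.
  by apply: (mulgI (theta' y)); rewrite mulgV -gmulfM mulgV.
rewrite /= /qeval -[x in LHS]reprK.
elim: (repr x) => [|[g b] w IH].
  by rewrite /word_eval big_nil; exact: T1.
have -> : \pi_words ((g, b) :: w) =
          (if b then (wgen g)^-1 else wgen g) * \pi_words w.
  apply: words_ext => K k uk qk.
  rewrite qeval_pi // [RHS]qevalM // qeval_pi // /word_eval big_cons.
  case: b; first by rewrite [qeval k _]qevalV // qeval_wgen.
  by rewrite qeval_wgen.
rewrite gmulfM IH /word_eval big_cons /letter /=.
by case: b; rewrite ?TV E.
Qed.

Theorem pol2_exists : inhabited (pol2 G).
Proof.
by split; apply: (Pol2 wgen_unital wgen_quadratic words_universal).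
Qed.

End Existence.

(* Main.v *)
(** Let f be unital polynomial on a perfect group.  Up to a right factor, its
    defect c_k(g) = f(kg) f(g)^-1 f(k)^-1 is a difference of f, so by induction on
    the degree it is a homomorphism in g.  Expanding f(k k^-1 g) gives
    f(k) c_(k^-1)(g) f(k)^-1 = c_k(g)^-1; the left side is a homomorphism in g,
    hence so is the pointwise inverse of c_k, which means that c_k has commutative
    image.  Perfectness then makes c_k trivial, that is, f is a homomorphism.
    Applied to the universal quadratic map, this makes it an inverse of pi. *)
Require Import Defs.
From HB Require Import structures.
From mathcomp Require Import all_boot.
From mathcomp Require Import boolp classical_sets.

Set Implicit Arguments.
Unset Strict Implicit.
Unset Printing Implicit Defensive.

Local Open Scope classical_set_scope.
Local Open Scope group_scope.

Lemma morph_unital (G H : groupType) (f : G -> H) :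
  {morph f : x y / x * y} -> unital f.
Proof. by move=> fM; apply: (mulgI (f 1)); rewrite -fM !mulg1. Qed.

Lemma morph_inv (G H : groupType) (f : G -> H) :
  {morph f : x y / x * y} -> {morph f : x / x^-1}.
Proof.
by move=> fM x; apply: (mulgI (f x)); rewrite -fM !mulgV (morph_unital fM).
Qed.

(** The kernel of [c] is a subgroup containing every commutator, hence the whole derived
    subgroup. *)
Lemma perfect_morph_abelian (G H : groupType) (c : G -> H) :
  perfect G -> {morph c : x y / x * y} -> (forall x y, commute (c x) (c y)) ->
  forall g, c g = 1.
Proof.
move=> Gp cM cC g.
have c1 := morph_unital cM.
have cV := morph_inv cM.
suff: derived_subgroup G `<=` [set x | c x = 1] by apply; rewrite Gp.
apply: smallest_sub => [|_ [x [y ->]]] /=.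
  split; last by move=> x y; rewrite !inE /= cM cV => -> ->; rewrite invg1 mulg1.
  by rewrite inE.
by rewrite /commg /conjg !cM !cV (cC x y) mulKg mulVg.
Qed.

(** The factor [(f k)^-1] makes the difference unital when [f] is, as the induction requires. *)
Definition defect (G H : groupType) (f : G -> H) (k g : G) : H :=
  gdiff k f g * (f k)^-1.

Lemma defectE (G H : groupType) (f : G -> H) (k g : G) :
  f (k * g) = defect f k g * f k * f g.
Proof. by rewrite /defect /gdiff !mulgVK. Qed.

Lemma defect_unital (G H : groupType) (f : G -> H) (k : G) :
  unital f -> unital (defect f k).
Proof. by move=> f1; rewrite /unital /defect /gdiff mulg1 f1 invg1 mulg1 mulgV. Qed.

Lemma polynomial_lt_mulr (G H : groupType) (n : nat) (f : G -> H) (a : H) :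
  polynomial_lt n.+1 f -> polynomial_lt n.+1 (fun g => f g * a).
Proof.
move=> fP k; suff -> : gdiff k (fun g => f g * a) = gdiff k f by exact: fP.
by apply/funext => g; rewrite /gdiff invgM mulgA mulgK.
Qed.

Lemma defect_inv (G H : groupType) (f : G -> H) (k g : G) :
  unital f -> {morph defect f k : x y / x * y} ->
  f k * defect f k^-1 g * (f k)^-1 = (defect f k g)^-1.
Proof.
move=> f1 cM.
(* This is [defectE] at [g = k^-1], where the left side is [f 1 = 1]. *)
have fkV : f k^-1 = (f k)^-1 * (defect f k k^-1)^-1.
  apply: (mulgI (defect f k k^-1 * f k)).
  by rewrite -defectE mulgV f1 mulgA mulgK mulgV.
have := defectE f k (k^-1 * g).
rewrite mulVKg cM (defectE f k^-1 g) fkV.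
set u := defect f k k^-1; set a := defect f k g; set b := defect f k^-1 g.
move=> E; apply: (mulgI (u * a)); rewrite mulgK.
apply: (mulIg (u^-1 * f g)).
by rewrite mulVKg [RHS]E !mulgA.
Qed.

Theorem polynomial_lt_perfect_morph (G : groupType) :
  perfect G -> forall (n : nat) (H : groupType) (f : G -> H),
  unital f -> polynomial_lt n f -> {morph f : x y / x * y}.
Proof.
move=> Gp; elim=> [|n IH] H f f1 fP; first by move=> x y; rewrite !fP mulg1.
have cM k : {morph defect f k : x y / x * y}.
  apply: IH; first exact: defect_unital.
  (* A right factor preserves degree at least 0 only. In the remaining case all differences of [f]
     are 1, so [f] is constantly [f 1 = 1]. *)
  case: n fP => [|n] fP; last exact: polynomial_lt_mulr.
  have f_1 x : f x = 1 by rewrite -(fP x 1) /gdiff mulg1 f1 invg1 mulg1.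
  by move=> g; rewrite /defect /gdiff !f_1 invg1 !mulg1.
suff c1 k g : defect f k g = 1 by move=> k g; rewrite defectE c1 mul1g.
apply: perfect_morph_abelian g => // x y; rewrite /commute.
(* Both inverses become the conjugate by [f k] of the same product of values of [defect f k^-1]. *)
apply: invg_inj; rewrite -cM -defect_inv // cM invgM -!defect_inv //.
by rewrite !mulgA mulgVK.
Qed.

Lemma pol2_proj_bijective (G : groupType) (P : pol2 G) :
  {morph pol2_map P : x y / x * y} -> bijective (pol2_proj P).
Proof.
move=> mM; exists (pol2_map P); last exact: pol2_projE.
have idM : {morph @id P : x y / x * y} by [].
have sM : {morph pol2_map P \o pol2_proj P : x y / x * y}.
  by move=> x y; rewrite /= gmulfM mM.
pose i : {multiplicative P -> P} :=
  HB.pack (@id P) (isMultiplicative.Build P P _ idM).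
pose s : {multiplicative P -> P} :=
  HB.pack (pol2_map P \o pol2_proj P) (isMultiplicative.Build P P _ sM).
have [theta [_ thetaU]] :=
  pol2_universal P (pol2_map_unital P) (pol2_map_quadratic P).
(* Both [s] and the identity extend [pol2_map P], so uniqueness identifies them. *)
have sE : s =1 theta by apply: thetaU => g; rewrite /= pol2_projE.
have iE : i =1 theta by apply: thetaU.
by move=> x; have := sE x; rewrite -iE.
Qed.

Theorem corollary1p5 (G : groupType) (Gperfect : perfect G) :
  (forall P : pol2 G, bijective (pol2_proj P)) /\
  (forall (n : nat) (H : groupType) (f : G -> H),
     unital f -> polynomial_lt n f -> {morph f : x y / (x * y)%g}).
Proof.
split=> [P|]; last exact: polynomial_lt_perfect_morph.
apply: pol2_proj_bijective; apply: (polynomial_lt_perfect_morph Gperfect (n := 3)).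
  exact: pol2_map_unital.
exact: pol2_map_quadratic.
Qed.
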